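(* Each transitive t.d.s. with the shadowing property is either mean equicontinuous or mean sensitive.
   Context: A t.d.s. (topological dynamical system) is a pair $(X,T)$ where $X$ is a non-empty compact metric space with metric $d$ and $T\colon X\to X$ is continuous; $\mathbb{N}$ denotes the positive integers and $\mathbb{Z}_+$ the non-negative integers. $(X,T)$ is transitive if for all non-empty open $U,V\subset X$ there is $n\in\mathbb{N}$ with $T^nU\cap V\neq\emptyset$. A sequence $\{x_n\}_{n=0}^\infty$ in $X$ is a $\delta$-pseudo-orbit for $T$ if $d(x_{n+1},Tx_n)<\delta$ for all $n\in\mathbb{Z}_+$, and it is $\varepsilon$-traced by $x\in X$ if $d(T^nx,x_n)<\varepsilon$ for all $n\in\mathbb{Z}_+$. $(X,T)$ has the shadowing property if for every $\varepsilon>0$ there is $\delta>0$ such that each $\delta$-pseudo-orbit for $T$ is $\varepsilon$-traced by some point of $X$. $(X,T)$ is mean equicontinuous if for every $x\in X$ and $\varepsilon>0$ there is $\delta>0$ such that for every $y\in X$ with $d(x,y)<\delta$ we have $\limsup_{n\to\infty}\frac1n\sum_{i=0}^{n-1}d(T^ix,T^iy)<\varepsilon$. $(X,T)$ is mean sensitive if there is $\delta>0$ such that for every non-empty open $U\subset X$ there are $x,y\in U$ with $\limsup_{n\to\infty}\frac1n\sum_{i=0}^{n-1}d(T^ix,T^iy)>\delta$. *)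

(* Defs.v *)
From HB Require Import structures.
From mathcomp Require Import all_boot all_order all_algebra.
From mathcomp Require Import all_classical all_reals all_analysis.

Set Implicit Arguments.
Unset Strict Implicit.
Unset Printing Implicit Defensive.

Import Order.TTheory GRing.Theory Num.Theory.
Import numFieldNormedType.Exports.

Local Open Scope classical_set_scope.
Local Open Scope ring_scope.

Section topological_dynamical_systems.
Context {R : realType} {X : metricType R}.
Implicit Types (T : X -> X) (x y : X).

Definition is_tds T : Prop :=
  [/\ [set: X] !=set0, compact [set: X] & continuous T].

Definition topologically_transitive T : Prop :=
  forall U V : set X, open U -> U !=set0 -> open V -> V !=set0 ->
  exists2 n : nat, (0 < n)%N & (iter n T @` U) `&` V !=set0.

Definition pseudo_orbit T (delta : R) (u : nat -> X) : Prop :=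
  forall n : nat, mdist (u n.+1) (T (u n)) < delta.

Definition traced T (eps : R) (u : nat -> X) x : Prop :=
  forall n : nat, mdist (iter n T x) (u n) < eps.

Definition shadowing_property T : Prop :=
  forall eps : R, 0 < eps ->
  exists2 delta : R, 0 < delta &
    forall u : nat -> X, pseudo_orbit T delta u -> exists x, traced T eps u x.

(* The average is taken with value 0 at n = 0, which does not affect the
   limsup.  The limsup is the one of extended reals, since [limn_sup] on R is
   only meaningful for bounded sequences. *)
Definition limsup_mean_dist T x y : \bar R :=
  limn_esup (fun n : nat =>
    (n%:R^-1 * \sum_(0 <= i < n) mdist (iter i T x) (iter i T y))%:E).

Definition mean_equicontinuous T : Prop :=
  forall x (eps : R), 0 < eps ->
  exists2 delta : R, 0 < delta &
    forall y, mdist x y < delta -> (limsup_mean_dist T x y < eps%:E)%E.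

Definition mean_sensitive T : Prop :=
  exists2 delta : R, 0 < delta &
    forall U : set X, open U -> U !=set0 ->
    exists x y, [/\ U x, U y & (delta%:E < limsup_mean_dist T x y)%E].

End topological_dynamical_systems.

(* Main.v *)
Require Import Defs.
From mathcomp Require Import all_boot all_order all_algebra.
From mathcomp Require Import all_classical all_reals all_analysis.
From mathcomp Require Import lra.

(** A point [x] at which mean equicontinuity fails makes the whole system mean
    sensitive: shadowing transports the failure into any open set.

    Suppose that points [y] arbitrarily close to [x] have
    [limsup_mean_dist T x y >= e], and let [U] be open and non-empty.  By
    transitivity some [w] in [U] has an iterate [iter n T w] as close to [x] as
    desired.  Following the orbit of [w] during [n] steps and then jumping onto
    the orbit of [x], or of a [y] close enough to [x], gives two pseudo-orbits
    that agree before time [n] ([shadowing_splice]).  The points [z] and [z']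
    tracing them are close to [w], hence in [U], and from time [n] on their
    distance is at least that of the orbits of [x] and [y], up to a small
    error.  A finite delay does not change a limsup of averages, so
    [limsup_mean_dist T z z'] is at least [e] up to the same error
    ([limsup_mean_dist_delay]).  The bound depends on [e] only, not on [U]. *)

Set Implicit Arguments.
Unset Strict Implicit.
Unset Printing Implicit Defensive.

Import Order.TTheory GRing.Theory Num.Theory.
Import numFieldNormedType.Exports.

Local Open Scope classical_set_scope.
Local Open Scope ring_scope.

Lemma frequently_gt_of_limn_esup (R : realType) (f : nat -> \bar R) (c : \bar R) :
  (c < limn_esup f)%E -> forall N : nat, exists2 m, (N <= m)%N & (c < f m)%E.
Proof.
move=> cf N; apply: contrapT => noM; move: cf; apply/negP; rewrite -leNgt.
rewrite /limn_esup limf_esupE.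
apply: (@le_trans _ _ (ereal_sup (f @` [set m | (N <= m)%N]))).
  by apply: ereal_inf_lbound; exists [set m | (N <= m)%N] => //; exact: nbhs_infty_ge.
apply: ge_ereal_sup => _ [m /= Nm <-]; rewrite leNgt; apply/negP => cfm.
by apply: noM; exists m.
Qed.

Lemma limn_esup_ge_of_frequently (R : realType) (f : nat -> \bar R) (c : \bar R) :
  (forall N : nat, exists2 m, (N <= m)%N & (c <= f m)%E) -> (c <= limn_esup f)%E.
Proof.
move=> freq; rewrite /limn_esup limf_esupE.
apply: le_ereal_inf_tmp => _ [V [N _ NV] <-].
have [m Nm cfm] := freq N; apply: le_trans cfm _.
by apply: ereal_sup_ubound; exists m => //; exact: NV.
Qed.

Section dynamics.
Context {R : realType} {X : metricType R}.
Variable T : X -> X.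
Implicit Types x y z w : X.

(** Over [m] steps of the orbits of [x] and [y] the orbits of [z] and [z'] make
    [n + m] steps, which multiplies the average by [m / (n + m)]; this factor
    tends to 1, and the margin between [c + eta] and [e] absorbs it. *)
Lemma limsup_mean_dist_delay (n : nat) (eta c e : R) x y z z' :
  (forall j, mdist (iter j T x) (iter j T y) <=
             mdist (iter (n + j) T z) (iter (n + j) T z') + eta) ->
  c + eta < e -> (e%:E <= limsup_mean_dist T x y)%E ->
  (c%:E <= limsup_mean_dist T z z')%E.
Proof.
move=> delay ce elim; set a := (c + eta + e) / 2.
have ae : (a%:E < limsup_mean_dist T x y)%E.
  by apply: lt_le_trans elim; rewrite lte_fin /a; lra.
apply: limn_esup_ge_of_frequently => N.
(* [K] is chosen so that [c * (n + m) <= (a - eta) * m] for all [m >= K]. *)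
pose K := Num.bound `|c * n%:R / (a - c - eta)|.
have [m] := frequently_gt_of_limn_esup ae (maxn N K).
rewrite geq_max => /andP[Nm Km] am.
exists (n + m)%N; first by rewrite (leq_trans Nm) ?leq_addl.
have gap : 0 < a - c - eta by rewrite /a; lra.
(* [Num.bound] is a successor, so [K <= m] excludes [m = 0]. *)
have m_gt0 : 0 < m%:R :> R.
  rewrite ltr0n lt0n; apply/eqP => m0; move: am Km; rewrite m0 leqn0 => _ /eqP.
  by rewrite /K /Num.bound.
have mK : c * n%:R <= (a - c - eta) * m%:R.
  rewrite [X in _ <= X]mulrC -ler_pdivrMr //.
  apply: (@le_trans _ _ K%:R); last by rewrite ler_nat.
  by rewrite (le_trans (ler_norm _))// ltW// archi_boundP.
move: am; rewrite lte_fin lee_fin mulrC ltr_pdivlMr// => am.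
have nm_gt0 : 0 < (n + m)%:R :> R by rewrite natrD ltr_wpDl.
rewrite mulrC ler_pdivlMr// natrD.
have tail : \sum_(0 <= i < m) mdist (iter i T x) (iter i T y) <=
    \sum_(0 <= i < m) mdist (iter (n + i) T z) (iter (n + i) T z') + eta * m%:R.
  apply: (le_trans (ler_sum _ (fun i _ => delay i))).
  by rewrite big_split/= sumr_const_nat subn0 mulr_natr.
have whole : \sum_(0 <= i < m) mdist (iter (n + i) T z) (iter (n + i) T z') <=
    \sum_(0 <= i < n + m) mdist (iter i T z) (iter i T z').
  rewrite (@big_cat_nat _ _ _ n 0%N (n + m)%N)//= ?leq_addr//.
  rewrite -{4}[n]add0n big_addn addKn.
  under [X in _ <= _ + X]eq_bigr do rewrite addnC.
  by rewrite ler_wpDl// sumr_ge0// => i _; exact: mdist_ge0.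
by move: mK; rewrite mulrDr !mulrBl => mK; clearbody a; lra.
Qed.

Lemma transitive_metric x y (a b : R) :
  topologically_transitive T -> 0 < a -> 0 < b ->
  exists2 n : nat, (0 < n)%N &
    exists2 w, mdist x w < a & mdist y (iter n T w) < b.
Proof.
move=> tt a0 b0.
have ball_center (v : X) (d : R) : 0 < d -> (interior (ball v d)) v.
  exact: nbhsx_ballx.
have [n n0 [_ [[w xw <-] yw]]] := tt _ _ (open_interior _)
  (ex_intro _ x (ball_center x a a0)) (open_interior _)
  (ex_intro _ y (ball_center y b b0)).
move: (interior_subset xw) (interior_subset yw); rewrite !ballEmdist => xw' yw'.
by exists n => //; exists w.
Qed.

(** The traced pseudo-orbit follows [w] during [n] steps and [p] afterwards.
    Its first term is [w] only because [n] is positive. *)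
Lemma shadowing_splice (eps : R) : shadowing_property T -> 0 < eps ->
  exists2 delta : R, 0 < delta &
    forall (n : nat) w p, (0 < n)%N -> mdist p (iter n T w) < delta ->
    exists2 z, mdist z w < eps &
      forall j, mdist (iter (n + j) T z) (iter j T p) < eps.
Proof.
move=> sh eps0; have [delta delta0 tr] := sh eps eps0.
exists delta => // n w p n0 pw.
pose u i := if (i < n)%N then iter i T w else iter (i - n) T p.
have [|z zu] := tr u.
  move=> i; rewrite /u; case: (ltngtP i.+1 n) => [lt_in|lt_ni|n_eq].
  - by rewrite mdistxx.
  - by rewrite subSn //= mdistxx.
  - by move: pw; rewrite -n_eq subnn.
exists z; first by have := zu 0%N; rewrite /u n0.
by move=> j; have := zu (n + j)%N; rewrite /u ltnNge leq_addr/= addKn.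
Qed.

(** The points obtained in an arbitrary open set trace the two orbits with
    error [e / 8] each, so their distance loses at most [e / 4] and their mean
    distance stays at least [e / 2]: this does not depend on the open set. *)
Lemma mean_sensitive_of_not_mean_equicontinuous_at x (e : R) :
  topologically_transitive T -> shadowing_property T -> 0 < e ->
  (forall delta : R, 0 < delta ->
     exists2 y, mdist x y < delta & (e%:E <= limsup_mean_dist T x y)%E) ->
  mean_sensitive T.
Proof.
move=> tt sh e0 bad; exists (e / 4); first lra.
move=> U oU [u Uu].
have /nbhs_ballP[r /= r0 rU] : nbhs u U by exact: open_nbhs_nbhs.
pose eps := Num.min (r / 2) (e / 8).
have eps0 : 0 < eps by rewrite lt_min; apply/andP; split; lra.
have [eps_r eps_e] : eps <= r / 2 /\ eps <= e / 8.
  by rewrite /eps !ge_min !lexx orbT.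
have [delta delta0 splice] := shadowing_splice sh eps0.
have half0 (a : R) : 0 < a -> 0 < a / 2 by move=> ?; lra.
have [n n0 [w uw xw]] := transitive_metric u x tt (half0 _ r0) (half0 _ delta0).
have [y xy ely] := bad _ (half0 _ delta0).
have [|z zw zx] := splice n w x n0; first by lra.
have [|z' z'w z'y] := splice n w y n0.
  have := metric_triangle y x (iter n T w); rewrite (metric_sym y x).
  by move=> yw; lra.
have inU v : mdist v w < eps -> U v.
  move=> vw; apply: rU; rewrite ballEmdist /=.
  by have := metric_triangle u w v; rewrite (metric_sym w v) => uv; lra.
exists z, z'; split; [exact: inU|exact: inU|].
apply: (@lt_le_trans _ _ (e / 2)%:E); first by rewrite lte_fin; lra.
apply: (@limsup_mean_dist_delay n (e / 4) _ e x y) => // [j|]; last lra.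
have := zx j; have := z'y j.
have := metric_triangle (iter j T x) (iter (n + j) T z) (iter j T y).
have := metric_triangle (iter (n + j) T z) (iter (n + j) T z') (iter j T y).
rewrite (metric_sym (iter j T x) (iter (n + j) T z)) => *; lra.
Qed.

End dynamics.

Theorem corollary5p7 (R : realType) (X : metricType R) (T : X -> X)
    (T_tds : is_tds T) (T_transitive : topologically_transitive T)
    (T_shadowing : shadowing_property T) :
  mean_equicontinuous T \/ mean_sensitive T.
Proof.
have [eqT|neqT] := pselect (mean_equicontinuous T); [by left|right].
have [x /existsNP[e /not_implyP[e0 nodelta]]] := (existsNP _).2 neqT.
apply: (@mean_sensitive_of_not_mean_equicontinuous_at _ _ T x e) => // delta delta0.
apply: contrapT => noy; apply: nodelta; exists delta => // y xy.
by rewrite ltNge; apply/negP => ely; apply: noy; exists y.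
Qed.
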